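(* Let $W$ be the set of articulation points for the finite connected digital image $(X,\kappa)$, with $W\neq\emptyset$. If $W$ is a proper subset of $X$, then $W$ is excludable from freezing sets for $(X,\kappa)$.
   Context: A digital image $(X,\kappa)$ is a set $X \subset \mathbb{Z}^n$ (for some $n \in \mathbb{N}$) together with an adjacency relation $\kappa$ on pairs of distinct points of $X$, i.e. $(X,\kappa)$ is a (simple, undirected) graph with vertex set $X$. Write $x \leftrightarrow_\kappa y$ if $x,y$ are $\kappa$-adjacent. A set $Y\subset X$ is $\kappa$-connected if for all $a,b\in Y$ there is a $\kappa$-path in $Y$ from $a$ to $b$, i.e. a finite sequence $\{y_i\}_{i=0}^m$ in $Y$ with $y_0=a$, $y_m=b$, and, for $0\le i<m$, $y_i=y_{i+1}$ or $y_i\leftrightarrow_\kappa y_{i+1}$. An articulation point of a connected $(X,\kappa)$ is a point $x\in X$ such that $(X\setminus\{x\},\kappa)$ is not connected. A function $f: X\to X$ is $\kappa$-continuous if it maps $\kappa$-connected subsets to $\kappa$-connected subsets; equivalently, $x \leftrightarrow_\kappa x'$ implies $f(x)=f(x')$ or $f(x)\leftrightarrow_\kappa f(x')$. $C(X,\kappa)$ is the set of $\kappa$-continuous functions $X \to X$, and $\mathrm{Fix}(f)=\{x\in X\mid f(x)=x\}$. A set $A\subset X$ is a freezing set for $(X,\kappa)$ if for every $g\in C(X,\kappa)$, $A\subset \mathrm{Fix}(g)$ implies $g=\mathrm{id}_X$. For a connected digital image $(X,\kappa)$, a set $W\subset X$ is excludable from freezing sets for $(X,\kappa)$ (excludable,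 for short) if for every freezing set $A$ of $(X,\kappa)$, if $A\setminus W\neq\emptyset$ then $A\setminus W$ is also a freezing set for $(X,\kappa)$. *)

(* Defs.v *)
From HB Require Import structures.
From mathcomp Require Import all_boot all_order all_algebra.
From mathcomp Require Import finmap.

Set Implicit Arguments.
Unset Strict Implicit.
Unset Printing Implicit Defensive.

Section DigitalTopology.

(* The point set is a finite type T (for a finite X in Z^n, the subtype of the
   points of X), and subsets of the image are finite sets over T. *)
Variables (T : finType) (kappa : rel T).

Implicit Types (A W Y : {set T}) (f g : T -> T).

Definition adjacent_or_equal : rel T := fun x y => (x == y) || kappa x y.

(* The path y_0, ..., y_m is the sequence a :: p. *)
Definition is_path_in Y (a b : T) (p : seq T) : Prop :=
  [/\ path adjacent_or_equal a p, all [in Y] (a :: p) & last a p = b].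

Definition connected_set Y : Prop :=
  forall a b, a \in Y -> b \in Y -> exists p, is_path_in Y a b p.

Definition connected_image : Prop := connected_set [set: T].

Definition articulation_point (x : T) : Prop := ~ connected_set [set~ x].

Definition continuous_map f : Prop :=
  forall Y, connected_set Y -> connected_set (f @: Y).

Definition Fix f : {set T} := [set x | f x == x].

Definition freezing_set A : Prop :=
  forall g, continuous_map g -> A \subset Fix g -> g =1 id.

Definition excludable W : Prop :=
  forall A, freezing_set A -> A :\: W != set0 -> freezing_set (A :\: W).

End DigitalTopology.

(* Main.v *)
Require Import Defs.
From HB Require Import structures.
From mathcomp Require Import all_boot all_order all_algebra.
From mathcomp Require Import finmap.

Set Implicit Arguments.
Unset Strict Implicit.
Unset Printing Implicit Defensive.

(** Let [A] be a freezing set. Collapsing a component [C] of [X \ {w}] to [w]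
    is continuous, so [A] meets [C]; if it does so only at an articulation
    point [a], then some component of [X \ {a}] is strictly smaller than [C]
    and contained in it, so by induction [C] contains a point of [A \ W]. Now
    let a continuous [g] fix [A \ W] pointwise, and let [w] be in [W].
    Choose [a1], [a2] in [A \ W] in distinct components of [X \ {w}] and
    shortest paths from each of them to [w]. If [g w <> w], then by minimality
    the images of these paths avoid [w], hence [a1] and [a2] are both in the
    component of [g w], a contradiction. So [g] fixes [A], and [g] is the
    identity. *)

Section ArticulationPoints.

Variables (T : finType) (kappa : rel T).
Hypothesis kappa_sym : symmetric kappa.
Hypothesis T_conn : connected_image kappa.

Local Notation e := (adjacent_or_equal kappa).
#[local] Arguments adjacent_or_equal : simpl never.

Implicit Types (w x y z : T) (g : T -> T) (A W : {set T}).

Lemma adjacent_or_equal_refl : reflexive e.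
Proof. by move=> x; rewrite /adjacent_or_equal eqxx. Qed.

Lemma adjacent_or_equal_sym : symmetric e.
Proof. by move=> x y; rewrite /adjacent_or_equal eq_sym kappa_sym. Qed.

Lemma connected_set2 x y : e x y -> connected_set kappa [set x; y].
Proof.
move=> exy a b; rewrite !inE => ha hb; exists [:: b]; split => //=; last first.
  by rewrite !inE ha hb.
rewrite andbT; case/orP: ha => /eqP->; case/orP: hb => /eqP-> //;
  by rewrite ?adjacent_or_equal_refl // adjacent_or_equal_sym.
Qed.

Lemma connected_set2_adj x y : connected_set kappa [set x; y] -> e x y.
Proof.
move=> /(_ x y); rewrite !inE !eqxx orbT => /(_ isT isT) [p [+ + <-]].
move=> + /= /andP[_]; elim: p => [|t p IHp] /=.
  by rewrite adjacent_or_equal_refl.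
case/andP=> ext tp /andP[]; rewrite !inE => /orP[] /eqP tE;
  rewrite {}tE in ext tp *.
  exact: IHp.
move=> hp; suff: last y p \in [set x; y].
  by rewrite !inE => /orP[] /eqP->; rewrite ?adjacent_or_equal_refl.
have: last y p \in y :: p by exact: mem_last.
rewrite inE => /orP[/eqP->|]; first by rewrite !inE eqxx orbT.
by move/(allP hp).
Qed.

Lemma continuous_mapP g :
  continuous_map kappa g <-> {homo g : x y / e x y}.
Proof.
split=> [gc x y exy | gh Y Yc _ _ /imsetP[a aY ->] /imsetP[b bY ->]].
  apply: connected_set2_adj; rewrite -!imset_set1 -imsetU.
  exact/gc/connected_set2.
have [p [ep pY <-]] := Yc _ _ aY bY; exists (map g p); split.
- exact: homo_path ep.
- rewrite -map_cons all_map; apply: sub_all pY => z /=; exact: imset_f.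
- by rewrite last_map.
Qed.

Definition avoiding w x y := [&& e x y, x != w & y != w].
#[local] Arguments avoiding w x y /.

Lemma connect_avoiding_sym w : connect_sym (avoiding w).
Proof.
apply: sym_connect_sym => x y.
by rewrite /= adjacent_or_equal_sym [(y != w) && _]andbC.
Qed.

Lemma connect_avoiding_neq w x y :
  x != w -> connect (avoiding w) x y -> y != w.
Proof.
move=> xw /connectP[p + ->]; elim: p x xw => //= t p IHp x _.
by case/andP=> /and3P[_ _ tw]; exact: IHp.
Qed.

Lemma path_avoiding w x p :
  path e x p -> w \notin x :: p -> path (avoiding w) x p.
Proof.
elim: p x => //= t p IHp x /andP[ext tp].
rewrite !inE !negb_or [w == x]eq_sym [w == t]eq_sym => /and3P[xw tw wp].
by rewrite ext xw tw IHp // !inE negb_or eq_sym tw.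
Qed.

Lemma path_ex x y : exists2 p, path e x p & last x p = y.
Proof. by have [p [? _ ?]] := T_conn (in_setT x) (in_setT y); exists p. Qed.

Lemma articulation_point_split w :
  articulation_point kappa w ->
  exists x y, [/\ x != w, y != w & ~~ connect (avoiding w) x y].
Proof.
move=> wart.
have [/existsP[x /existsP[y /and3P[xw yw cxy]]]|no] :=
  boolP [exists x, exists y, [&& x != w, y != w & ~~ connect (avoiding w) x y]].
  by exists x, y.
case: wart => x y; rewrite !inE => xw yw.
have /connectP[p pxy ->] : connect (avoiding w) x y.
  apply: contraNT no => cxy; apply/existsP; exists x; apply/existsP; exists y.
  by rewrite xw yw.
exists p; split => //; first by apply: sub_path pxy => u v /and3P[].
apply/allP=> z; rewrite !inE => /orP[/eqP->//|zp].
elim: p x {xw} pxy zp => //= t p IHp x /andP[/and3P[_ _ tw] pt].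
by rewrite inE => /orP[/eqP->//|]; exact: IHp pt.
Qed.

Lemma freezing_set_meets w x A :
  freezing_set kappa A -> x != w ->
  exists2 a, a \in A & connect (avoiding w) x a.
Proof.
move=> Afr xw; apply/exists_inP.
apply: contraT => /exists_inPn noA; case/eqP: (xw).
pose g z := if connect (avoiding w) x z then w else z.
have g_exit y z : e y z -> connect (avoiding w) x y ->
    ~~ connect (avoiding w) x z -> y != w -> z = w.
  move=> eyz cy ncz yw; apply/eqP; apply: contraNT ncz => zw.
  by apply: connect_trans cy (connect1 _); rewrite /= eyz yw.
have neqw z : connect (avoiding w) x z -> z != w.
  exact: connect_avoiding_neq.
have gc : continuous_map kappa g.
  apply/continuous_mapP => y z eyz; rewrite /g.
  case: ifPn => cy; case: ifPn => cz //; first exact: adjacent_or_equal_refl.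
    by rewrite (g_exit _ _ eyz cy cz (neqw _ cy)) adjacent_or_equal_refl.
  rewrite adjacent_or_equal_sym in eyz.
  by rewrite (g_exit _ _ eyz cz cy (neqw _ cz)) adjacent_or_equal_refl.
have /(Afr g gc)/(_ x) : A \subset Fix g.
  by apply/subsetP=> a aA; rewrite inE /g (negbTE (noA a aA)).
by rewrite /g connect0.
Qed.

Lemma connect_avoiding_cut w a y z :
  a != w -> y != a -> ~~ connect (avoiding a) y w ->
  connect (avoiding a) y z -> connect (avoiding w) z a.
Proof.
move=> aw ya nyw; have neqw t : connect (avoiding a) y t -> t != w.
  by move=> cyt; apply: contraNneq nyw => <-.
have [p] := path_ex z a; elim: p z => [z _ /= -> //|t p IHp z /=].
case/andP=> ezt tp pa cyz.
have [ta|ta] := eqVneq t a.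
  by rewrite ta in ezt; apply: connect1; rewrite /= ezt aw neqw.
have cyt : connect (avoiding a) y t.
  apply: (connect_trans cyz (connect1 _)).
  by rewrite /= ezt ta (connect_avoiding_neq ya cyz).
by apply: connect_trans (connect1 _) (IHp t tp pa cyt); rewrite /= ezt !neqw.
Qed.

Lemma freezing_set_meets_diff w x A W :
  (forall a, a \in W -> articulation_point kappa a) ->
  freezing_set kappa A -> x != w ->
  exists2 a, a \in A :\: W & connect (avoiding w) x a.
Proof.
move=> Wart Afr.
have [n] := ubnP #|connect (avoiding w) x|; elim: n w x => // n IHn w x.
rewrite ltnS => le_n xw; have [a aA cxa] := freezing_set_meets Afr xw.
have [aW|aW] := boolP (a \in W); last by exists a; rewrite // inE aW.
have aw := connect_avoiding_neq xw cxa.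
have [y ya ncy] : exists2 y, y != a & ~~ connect (avoiding a) y w.
  have [y [z [ya za ncyz]]] := articulation_point_split (Wart a aW).
  have [cyw|] := boolP (connect (avoiding a) y w); last by exists y.
  exists z => //; apply: contra ncyz => czw.
  by apply: connect_trans cyw _; rewrite connect_avoiding_sym.
have sub z : connect (avoiding a) y z -> connect (avoiding w) x z.
  move=> cyz; apply: connect_trans cxa _; rewrite connect_avoiding_sym.
  exact: connect_avoiding_cut cyz.
have [|//|b bAW cyb] := IHn a y; last by exists b => //; exact: sub.
apply: leq_trans le_n; apply: proper_card; apply/properP; split.
  by apply/subsetP => z; rewrite !unfold_in; exact: sub.
exists a; rewrite unfold_in //.
by apply: contraTN isT => /(connect_avoiding_neq ya); rewrite eqxx.
Qed.

(* The image of a path of minimal length from [a] to [w] avoids [w], as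
   otherwise one of its proper prefixes would be a shorter path. *)
Lemma continuous_map_connect_avoiding g a w :
  continuous_map kappa g -> g a = a -> g w != w ->
  connect (avoiding w) a (g w).
Proof.
move=> /continuous_mapP gh ga gw; have [p] := path_ex a w.
have [n] := ubnP (size p); elim: n p => // n IHn p; rewrite ltnS => le_n ep pw.
have egp : path e a (map g p) by rewrite -ga; exact: homo_path ep.
have lgp : last a (map g p) = g w by rewrite -{1}ga last_map pw.
have [|wgp] := boolP (w \in a :: map g p); last first.
  by apply/connectP; exists (map g p) => //; exact: path_avoiding.
rewrite inE => /orP[/eqP wa|wgp]; first by rewrite wa ga eqxx in gw.
case/splitPr def_p: _ / wgp egp lgp => [p1 p2].
rewrite cat_path last_cat /= => /and3P[ep1 ew _] lw.
apply: (IHn (rcons p1 w)); rewrite ?last_rcons ?rcons_path ?ep1 //.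
apply: leq_trans le_n; rewrite -(size_map g p) def_p size_cat size_rcons /=.
case: p2 lw {def_p} => [/= gwE|t p2 _]; first by rewrite -gwE eqxx in gw.
by rewrite /= !addnS !ltnS leq_addr.
Qed.

Lemma articulation_points_excludable W :
  (forall a, a \in W -> articulation_point kappa a) -> excludable kappa W.
Proof.
move=> Wart A Afr _ g gc /subsetP gfix; apply: (Afr g gc).
apply/subsetP => w wA; have [wW|wW] := boolP (w \in W); last first.
  by apply: gfix; rewrite inE wW.
rewrite inE; apply: contraT => gw.
have [x [y [xw yw /negP[]]]] := articulation_point_split (Wart w wW).
have toward z : z != w -> connect (avoiding w) z (g w).
  move=> zw; have [a aAW cza] := freezing_set_meets_diff Wart Afr zw.
  apply: connect_trans cza (continuous_map_connect_avoiding gc _ gw).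
  by have := gfix a aAW; rewrite inE => /eqP.
apply: connect_trans (toward x xw) _.
by rewrite connect_avoiding_sym toward.
Qed.

End ArticulationPoints.

Theorem theorem5p3 (n : nat) (X : {fset 'rV[int]_n}) (kappa : rel X)
    (kappa_sym : symmetric kappa) (kappa_irr : irreflexive kappa)
    (X_conn : connected_image kappa)
    (W : {set X})
    (W_def : forall x : X, x \in W <-> articulation_point kappa x)
    (W_neq0 : W != set0)
    (W_proper : W \proper [set: X]) :
  excludable kappa W.
Proof.
apply: articulation_points_excludable => // a; exact: (W_def a).1.
Qed.
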